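(* Let $\mathcal{E}$ be a collection of spaces and let $f:X\to Y$ and $g:Y\to Z$ be maps. Then $$\mathcal{E}\text{-}\mathrm{cat}_{\mathrm{CP}}(g)\le\mathcal{E}\text{-}\mathrm{cat}_{\mathrm{CP}}(Y)\le\mathcal{E}\text{-}\mathrm{secat}(f).$$
   Context: All spaces are assumed to have the homotopy type of connected CW-complexes; spaces have no base points and maps are not required to preserve base points. A collection $\mathcal{E}$ of spaces means any collection of spaces containing the one-point space $*$. Given $f:X\to Y$, a subset $U\subseteq Y$ with inclusion $i:U\hookrightarrow Y$ is $\mathcal{E}$-section-categorical (with respect to $f$) if there are a space $E\in\mathcal{E}$ and maps $u:U\to E$, $v:E\to X$ with $fvu\simeq i$. The (reduced) $\mathcal{E}$-sectional category $\mathcal{E}\text{-}\mathrm{secat}(f)$ is the smallest integer $n\ge 0$ such that $Y$ has an open cover by $n+1$ subsets each of which is $\mathcal{E}$-section-categorical with respect to $f$ (and $\infty$ if no such $n$ exists). The (reduced) $\mathcal{E}$-Clapp-Puppe category $\mathcal{E}\text{-}\mathrm{cat}_{\mathrm{CP}}(f)$ of a map $f:X\to Y$ is the smallest integer $n\ge0$ such that there are an open cover $\{U_0,\dots,U_n\}$ of $X$, spaces $E_i\in\mathcal{E}$ and maps $u_i:U_i\to E_i$, $v_i:E_i\to Y$ with $f|_{U_i}\simeq v_iu_i$ for each $i$ ($\infty$ if no such $n$ exists). For a space $X$, $\mathcal{E}\text{-}\mathrm{cat}_{\mathrm{CP}}(X)=\mathcal{E}\text{-}\mathrm{cat}_{\mathrm{CP}}(\mathrm{id}_X)$.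 *)

(* Defs.v *)
From HB Require Import structures.
From mathcomp Require Import all_boot all_order all_algebra.
From mathcomp Require Import all_classical all_reals all_analysis.

Set Implicit Arguments.
Unset Strict Implicit.
Unset Printing Implicit Defensive.

Import Order.TTheory GRing.Theory Num.Theory.
Import numFieldNormedType.Exports.

Local Open Scope classical_set_scope.
Local Open Scope ring_scope.

Section Homotopy.
Variable R : realType.

(* The homotopy is a total function on X * R of which only the restriction to
   X * [0, 1] is constrained. *)
Definition homotopic (X Y : topologicalType) (f g : X -> Y) : Prop :=
  exists H : X * R -> Y,
    [/\ {within [set: X] `*` `[0, 1], continuous H},
        forall x, H (x, 0) = f x &
        forall x, H (x, 1) = g x].

Definition homotopy_equivalent (X Y : topologicalType) : Prop :=
  exists (f : X -> Y) (g : Y -> X),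
    [/\ continuous f, continuous g,
        homotopic (g \o f) idfun & homotopic (f \o g) idfun].

End Homotopy.

Definition sqnorm (R : realType) (n : nat) (v : 'rV[R]_n) : R :=
  \sum_(i < n) v ord0 i ^+ 2.

Definition closed_disk (R : realType) (n : nat) : set 'rV[R]_n :=
  [set v | sqnorm v <= 1].
Definition open_disk (R : realType) (n : nat) : set 'rV[R]_n :=
  [set v | sqnorm v < 1].
Definition unit_sphere (R : realType) (n : nat) : set 'rV[R]_n :=
  [set v | sqnorm v = 1].

Arguments closed_disk R n _ : clear implicits.
Arguments open_disk R n _ : clear implicits.
Arguments unit_sphere R n _ : clear implicits.

Section CWComplexes.
Variable R : realType.

(* A CW structure on X, given by its family of characteristic maps (constrained
   only on the closed disks), in J.H.C. Whitehead's intrinsic form.  That Phi c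
   restricts to a homeomorphism from the open disk onto its image need not be
   required: it follows from injectivity, the Hausdorff property and compactness
   of the closed disk, since the sphere is sent into other cells. *)
Record is_CW_structure (X : topologicalType) (cell : Type) (dim : cell -> nat)
    (Phi : forall c : cell, 'rV[R]_(dim c) -> X) : Prop := IsCWStructure {
  cw_hausdorff : hausdorff_space X;
  cw_continuous : forall c, {within closed_disk R (dim c), continuous (Phi c)};
  cw_injective : forall c, set_inj (open_disk R (dim c)) (Phi c);
  cw_disjoint : forall c d : cell, c <> d ->
    Phi c @` open_disk R (dim c) `&` Phi d @` open_disk R (dim d) = set0;
  cw_cover : \bigcup_(c in [set: cell]) (Phi c @` open_disk R (dim c)) = [set: X];
  cw_closure_finite : forall c, exists F : set cell,
    [/\ finite_set F, forall d, F d -> (dim d < dim c)%N &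
        Phi c @` unit_sphere R (dim c) `<=`
          \bigcup_(d in F) (Phi d @` open_disk R (dim d))];
  cw_weak_topology : forall A : set X,
    closed A <-> forall c, closed (closed_disk R (dim c) `&` Phi c @^-1` A)
}.

Definition CW_complex (X : topologicalType) : Prop :=
  exists (cell : Type) (dim : cell -> nat)
         (Phi : forall c : cell, 'rV[R]_(dim c) -> X), is_CW_structure Phi.

(* [connected] holds of the empty set, whence the nonemptiness clause. *)
Definition has_connected_CW_type (X : topologicalType) : Prop :=
  exists K : topologicalType,
    [/\ CW_complex K, [set: K] !=set0, connected [set: K] &
        homotopy_equivalent R X K].

End CWComplexes.

Section Invariants.
Variable R : realType.

Definition one_point_space (P : topologicalType) : Prop :=
  exists p : P, [set: P] = [set p].

Definition collection_of_spaces (E : topologicalType -> Prop) : Prop :=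
  (forall S : topologicalType, E S -> has_connected_CW_type R S) /\
  (exists2 P : topologicalType, E P & one_point_space P).

Definition least_or_infty (P : nat -> Prop) : \bar R :=
  match pselect (exists n, `[< P n >]) with
  | left exP => (ex_minn exP)%:R%:E
  | right _ => +oo%E
  end.

Definition open_cover (X : topologicalType) (n : nat)
    (U : 'I_n -> set X) : Prop :=
  (forall i, open (U i)) /\ \bigcup_(i in [set: 'I_n]) U i = [set: X].

Variable E : topologicalType -> Prop.

(* The subset U, as a space, is the coerced type [set_type U] with the subspace
   topology, and its inclusion is [set_val]. *)
Definition section_categorical (X Y : topologicalType) (f : X -> Y)
    (U : set Y) : Prop :=
  exists S : topologicalType, E S /\
    exists (u : U -> S) (v : S -> X),
      [/\ continuous u, continuous v &
          homotopic R (f \o v \o u) (set_val : U -> Y)].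

Definition secat (X Y : topologicalType) (f : X -> Y) : \bar R :=
  least_or_infty (fun n => exists U : 'I_n.+1 -> set Y,
    open_cover U /\ forall i, section_categorical f (U i)).

Definition catCP (X Y : topologicalType) (f : X -> Y) : \bar R :=
  least_or_infty (fun n => exists U : 'I_n.+1 -> set X,
    open_cover U /\
    forall i, exists S : topologicalType, E S /\
      exists (u : U i -> S) (v : S -> Y),
        [/\ continuous u, continuous v &
            homotopic R (f \o (set_val : U i -> X)) (v \o u)]).

Definition catCP_space (X : topologicalType) : \bar R := catCP (@idfun X).

End Invariants.

(* Main.v *)
Require Import Defs.
From mathcomp Require Import all_boot all_order all_algebra.
From mathcomp Require Import all_classical all_reals all_analysis.

(** Both inequalities hold because an open cover that witnesses the larger
    invariant witnesses the smaller one as well, with the same members of [E].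

    If the inclusion of [U] into [Y] is homotopic to [v \o u] through [S], then
    composing that homotopy with [g] ([homotopic_postcomp]) gives a
    factorization of the restriction of [g] to [U] through [S], namely
    [(g \o v) \o u].  If [U] is section-categorical for [f], so that
    [f \o v \o u] is homotopic to the inclusion, then [f \o v] is the second map
    of a factorization of the inclusion itself; the two definitions write the
    homotopy in opposite directions, which costs one use of [homotopic_sym].

    The comparison of covers turns into a comparison of the extended reals by
    [least_or_infty_anti]. *)

Import Order.TTheory GRing.Theory Num.Theory.
Import numFieldNormedType.Exports.

Local Open Scope classical_set_scope.
Local Open Scope ring_scope.

Lemma homotopic_postcomp (R : realType) (X Y Z : topologicalType)
    (h k : X -> Y) (g : Y -> Z) :
  continuous g -> homotopic R h k -> homotopic R (g \o h) (g \o k).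
Proof.
move=> cg [H [/subspace_continuousP cH H0 H1]]; exists (g \o H);
  split => [|x|x] /=.
- by apply/subspace_continuousP => p Ap; apply: cvg_comp (cH p Ap) (cg _).
- by rewrite H0.
- by rewrite H1.
Qed.

Lemma homotopic_sym (R : realType) (X Y : topologicalType) (h k : X -> Y) :
  homotopic R h k -> homotopic R k h.
Proof.
move=> [H [/subspace_continuousP cH H0 H1]].
pose r (p : X * R) : X * R := (p.1, 1 - p.2).
pose A : set (X * R) := [set: X] `*` `[0, 1].
have rA p : A p -> A (r p).
  move=> [_ /=]; rewrite in_itv /= => /andP[p0 p1].
  by split=> //=; rewrite in_itv /= subr_ge0 p1 lerBlDr lerDl.
have cr : continuous r.
  move=> p; apply: (@cvg_pair _ _ _ _ (nbhs p.1) (nbhs (1 - p.2)));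
    first exact: cvg_fst.
  by apply: cvgB; [exact: cvg_cst | exact: cvg_snd].
exists (H \o r); split => [|x|x] /=.
- apply/subspace_continuousP => p Ap.
  apply: (cvg_comp _ _ _ (cH _ (rA _ Ap))).
  (* The homotopy is continuous only relative to [A]; the reflection is
     continuous on all of [X * R] and preserves [A], so it carries points of [A]
     near [p] to points of [A] near [r p]. *)
  move=> B /cr; apply: (@filterS _ (nbhs p)) => q rqB /rA.
  exact: rqB.
- by rewrite /r /= subr0 H1.
- by rewrite /r /= subrr H0.
Qed.

Lemma least_or_infty_anti (R : realType) (P Q : nat -> Prop) :
  (forall n, Q n -> P n) -> (least_or_infty R P <= least_or_infty R Q)%E.
Proof.
move=> QP; rewrite /least_or_infty.
case: pselect => [exP|noP]; case: pselect => [exQ|_]; rewrite ?leey //.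
  case: ex_minnP => m _ minm; case: ex_minnP => n /asboolP/QP/asboolP Pn _.
  by rewrite lee_fin ler_nat minm.
by case: noP; case: exQ => n /asboolP/QP/asboolP Pn; exists n.
Qed.

Theorem proposition5p7 (R : realType) (E : topologicalType -> Prop)
    (X Y Z : topologicalType) (f : X -> Y) (g : Y -> Z)
    (hE : collection_of_spaces R E)
    (hX : has_connected_CW_type R X)
    (hY : has_connected_CW_type R Y)
    (hZ : has_connected_CW_type R Z)
    (hf : continuous f) (hg : continuous g) :
  (catCP R E g <= catCP_space R E Y <= secat R E f)%E.
Proof.
apply/andP; split; apply: least_or_infty_anti => n [U [coverU facU]];
    exists U; split=> // i; have [S [ES [u [v [cu cv huv]]]]] := facU i;
    exists S; split=> //.
- exists u, (g \o v); split=> //; last exact: homotopic_postcomp huv.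
  by move=> s; apply: continuous_comp; [exact: cv | exact: hg].
- exists u, (f \o v); split=> //; last exact: homotopic_sym huv.
  by move=> s; apply: continuous_comp; [exact: cv | exact: hf].
Qed.
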